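(* The parameters $n,k,\lambda,\mu$ of nontrivial strongly regular graphs satisfy $$\lambda = k^2/n + o(n) \quad\text{and}\quad \mu = k^2/n + o(n)$$ as $n\to\infty$. That is: for every $\varepsilon>0$ there exists $n_0$ such that for every nontrivial strongly regular graph with parameters $n,k,\lambda,\mu$ and $n\ge n_0$, $$\left|\lambda - \frac{k^2}{n}\right| \le \varepsilon n \quad\text{and}\quad \left|\mu - \frac{k^2}{n}\right| \le \varepsilon n.$$
   Context: Graphs are finite and simple. For a set $R$ of vertices of a graph $G$, the codegree $\widehat{d}(R)$ is the number of vertices of $G$ joined to every vertex in $R$; write $\widehat d(uv)$ for $\widehat d(\{u,v\})$. A strongly regular graph (srg) with parameters $n,k,\lambda,\mu$ is a $k$-regular graph of order $n$ such that, for distinct vertices $u,v$, $\widehat{d}(uv)=\lambda$ if $uv$ is an edge and $\widehat{d}(uv)=\mu$ if $uv$ is not an edge. A strongly regular graph is called trivial if it or its complement is a union of disjoint cliques (i.e. it is a graph $rK_m$, a disjoint union of $r$ complete graphs on $m$ vertices, or the complement of such a graph); otherwise it is nontrivial. *)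

(* Defs.v *)
From mathcomp Require Import all_boot all_order all_algebra.
From mathcomp Require Import reals.

Set Implicit Arguments.
Unset Strict Implicit.
Unset Printing Implicit Defensive.

(* A graph on the finite vertex set T is given by its adjacency relation. *)
Definition simple_graph (T : finType) (e : rel T) : Prop :=
  symmetric e /\ irreflexive e.

Definition compl_graph (T : finType) (e : rel T) : rel T :=
  [rel u v | (u != v) && ~~ e u v].

Definition degree (T : finType) (e : rel T) (u : T) : nat :=
  #|[set w | e u w]|.

Definition codegree (T : finType) (e : rel T) (A : {set T}) : nat :=
  #|[set w | [forall u in A, e u w]]|.

(* If no pair of distinct vertices is adjacent (resp. nonadjacent), l (resp. m)
   is unconstrained; such graphs are trivial in the sense below. *)
Definition strongly_regular (T : finType) (e : rel T) (n k l m : nat) : Prop :=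
  [/\ simple_graph e,
      #|T| = n,
      forall u : T, degree e u = k,
      forall u v : T, u != v -> e u v -> codegree e [set u; v] = l
    & forall u v : T, u != v -> ~~ e u v -> codegree e [set u; v] = m].

(* The graph is r K_m: the vertices split into r blocks of size m, and two
   distinct vertices are adjacent exactly when they share a block. *)
Definition is_rK (T : finType) (e : rel T) (r m : nat) : Prop :=
  exists P : {set {set T}},
    [/\ partition P [set: T],
        #|P| = r,
        forall B : {set T}, B \in P -> #|B| = m
      & forall u v : T,
          e u v = (u != v) && [exists B in P, (u \in B) && (v \in B)]].

Definition trivial_graph (T : finType) (e : rel T) : Prop :=
  exists r m : nat, is_rK e r m \/ is_rK (compl_graph e) r m.

(* Main.v *)
(** Double counting gives n mu = k^2 - k (lambda - mu) - (k - mu), so it is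
    enough that lambda - mu = o(n).  Let s and t be the roots of
    x^2 - (lambda - mu) x - (k - mu), with |t| >= |lambda - mu| / 2, and let A
    be the adjacency matrix.  Then P = (A - s I - ((k - s) / n) J) / (t - s) is
    idempotent, so its rank equals its trace, (s - n s - k) / (t - s).  If
    |lambda - mu| >= delta n, then |s| = (k - mu) / |t| <= 2 / delta and
    |t - s| >= delta n, which bounds the rank by a constant r depending only on
    delta.  But an entry of P is determined by two bits, the equality and the
    adjacency of its indices, and the rows of P are pairwise distinct unless
    s = 0 or s = -1, in which case the graph is trivial; as a row is
    determined by its entries in r columns spanning the column space,
    n <= 4^r. *)

Require Import Defs.
From mathcomp Require Import all_boot all_order all_algebra.
From mathcomp Require Import reals.
From mathcomp Require Import ring lra.
Import Order.TTheory GRing.Theory Num.Theory.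
Local Open Scope ring_scope.

Set Implicit Arguments.
Unset Strict Implicit.
Unset Printing Implicit Defensive.

(** * Rank of idempotent matrices and of matrices with few distinct entries *)

Lemma idempotent_rank_trace (F : fieldType) (n : nat) (P : 'M[F]_n) :
  P *m P = P -> (\rank P)%:R = \tr P.
Proof.
move=> PP.
(* For the full-rank factorization [P = C R], idempotence reads [C (R C) R = C R]. Both outer
   factors cancel, and the trace of [C R] is that of the identity [R C]. *)
have RC : row_base P *m col_base P = 1%:M.
  apply: (row_full_inj (col_base_full P)).
  apply: (row_free_inj (row_base_free P)) => /=.
  move: (mulmx_base P); move: (col_base P) (row_base P) => C R CR.
  by rewrite mulmx1 !mulmxA CR -mulmxA CR PP.
by rewrite -[in RHS](mulmx_base P) mxtrace_mulC RC mxtrace1.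
Qed.

Lemma row_count_le_exp_rank (F : fieldType) (C : finType) (m n : nat)
    (B : 'M[F]_(m, n)) (g : C -> F) (c : 'I_m -> 'I_n -> C) :
  (forall i j, B i j = g (c i j)) ->
  injective (fun i => row i B) -> (m <= #|C| ^ \rank B)%N.
Proof.
move=> Bg rowB_inj.
(* [maxrankfun] selects rows, so the transpose is used to get [\rank B] columns of [B] that span its
   column space. *)
have [D BD] : exists D, B = colsub (maxrankfun B^T) B *m D.
  have /submxP[D BD] : (B^T <= rowsub (maxrankfun B^T) B^T)%MS.
    by rewrite eq_maxrowsub.
  exists D^T; apply: trmx_inj; rewrite trmx_mul trmxK {1}BD.
  by congr (_ *m _); apply/matrixP => i j; rewrite !mxE.
pose h i := [ffun j => c i (maxrankfun B^T j)].
have h_inj : injective h.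
  move=> i1 i2 /ffunP hE; apply: rowB_inj => /=.
  rewrite BD !row_mul; congr (_ *m _); apply/rowP => j.
  by rewrite !mxE !Bg; have := hE j; rewrite !ffunE => ->.
by have := leq_card h h_inj; rewrite card_ffun !card_ord mxrank_tr.
Qed.

(** * Regular graphs with transitive adjacency *)

Section SimpleGraph.

Variables (T : finType) (e : rel T).
Hypothesis sg : simple_graph e.

Lemma degree_compl (u : T) : degree (compl_graph e) u = (#|T| - (degree e u).+1)%N.
Proof.
have [esym eirr] := sg.
have uN : u \notin [set w | e u w] by rewrite inE eirr.
rewrite /degree -[X in (_ - X.+1)%N]add0n -addSn -add1n.
have -> : [set w | compl_graph e u w] = ~: (u |: [set w | e u w]).
  by apply/setP => w; rewrite !inE negb_or eq_sym.
by rewrite cardsCs setCK cardsU1 uN addn0.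
Qed.

Lemma compl_simple : simple_graph (compl_graph e).
Proof.
have [esym eirr] := sg; split=> [u v|u]; rewrite /compl_graph /=; last by rewrite eqxx.
by rewrite eq_sym esym.
Qed.

(** With equality added, adjacency becomes an equivalence relation whose classes are closed
    neighbourhoods, hence of size [k.+1]. *)
Lemma regular_transitive_rK (k : nat) :
  (forall u, degree e u = k) ->
  (forall u v w, e u v -> e v w -> u != w -> e u w) ->
  exists r m, is_rK e r m.
Proof.
have [esym eirr] := sg => deg_k e_tr.
pose E := [rel u v | (u == v) || e u v].
have E_eq : {in [set: T] & &, equivalence_rel E}.
  move=> u v w _ _ _; rewrite /E /=; split; first by rewrite eqxx.
  case/orP => [/eqP -> //|euv].
  apply/idP/idP => /orP[/eqP <-|].
  - by rewrite esym euv orbT.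
  - move=> euw; case: (eqVneq v w) => //= vw.
    by apply: (e_tr v u w) => //; rewrite esym.
  - by rewrite euv orbT.
  - by move=> evw; case: (eqVneq u w) => //= uw; apply: (e_tr u v w).
pose P := equivalence_partition E [set: T].
have partP : partition P [set: T] := equivalence_partitionP E_eq.
exists #|P|, k.+1, P; split=> // [B|u v].
  case/imsetP => u _ ->.
  have -> : [set v in [set: T] | E u v] = u |: [set w | e u w].
    by apply/setP => v; rewrite !inE eq_sym.
  by rewrite cardsU1 inE eirr add1n; congr _.+1; apply: deg_k.
apply/idP/andP => [euv|[uv /existsP[B /and3P[/imsetP[x _ ->]]]]].
  split; first by apply: contraTneq euv => ->; rewrite eirr.
  apply/existsP; exists [set w in [set: T] | E u w].
  by rewrite imset_f ?inE //= eqxx euv orbT.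
rewrite !inE /= => Exu Exv.
have := (E_eq x u v (in_setT _) (in_setT _) (in_setT _)).2 Exu.
by rewrite /E /= Exv (negPf uv).
Qed.

End SimpleGraph.

(** * Parameters that force triviality *)

Section StronglyRegular.

Variables (T : finType) (e : rel T) (n k l m : nat).
Hypothesis srg : strongly_regular e n k l m.

Lemma codegree2E (u v : T) :
  codegree e [set u; v] = #|[set w | e u w] :&: [set w | e v w]|.
Proof.
rewrite /codegree; congr #|pred_of_set _|; apply/setP => w; rewrite !inE.
apply/forallP/andP => [H|[Hu Hv] x].
  by have := H u; have := H v; rewrite !inE !eqxx orbT.
by rewrite !inE; apply/implyP => /orP[] /eqP ->.
Qed.

(** For an edge [uv], the common neighbours lie among the [k - 1] neighbours of [v] other than [u].
    By cardinality they exhaust them, so adjacency is transitive. *)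
Lemma srg_lambda_trivial : l.+1 = k -> trivial_graph e.
Proof.
have [sg _ deg adj nadj] := srg; have [esym eirr] := sg => lk.
have [|r [q rq]] := regular_transitive_rK sg deg; last by exists r, q; left.
move=> u v w euv evw uw.
have uv : u != v by apply: contraTneq euv => ->; rewrite eirr.
have uN : u \in [set x | e v x] by rewrite inE esym.
have /eqP/setP/(_ w) : [set x | e u x] :&: [set x | e v x] == [set x | e v x] :\ u.
  rewrite eqEcard; apply/andP; split.
    apply/subsetP => x; rewrite !inE => /andP[eux ->]; rewrite andbT.
    by apply: contraTneq eux => ->; rewrite eirr.
  rewrite -codegree2E adj //; have := deg v; rewrite /degree (cardsD1 u) uN -lk.
  by rewrite add1n => -[->].
by rewrite !inE evw (eq_sym w) uw !andbT.
Qed.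

(** The equation is tied to a nonadjacent pair because [m] is arbitrary in a complete graph.
    Nonadjacent vertices then have equal neighbourhoods, so nonadjacency is transitive. *)
Lemma srg_mu_trivial :
  (forall u v, u != v -> ~~ e u v -> m = k) -> trivial_graph e.
Proof.
have [sg _ deg adj nadj] := srg; have [esym eirr] := sg => mk.
have [||r [q rq]] := @regular_transitive_rK _ _ (compl_simple sg) (#|T| - k.+1).
- by move=> u; rewrite degree_compl // deg.
- move=> u v w; rewrite /compl_graph /= => /andP[uv euv] /andP[vw evw] uw.
  rewrite uw /=.
  apply: contra evw => euw.
  have /eqP/setP/(_ w) : [set x | e u x] :&: [set x | e v x] == [set x | e u x].
    rewrite eqEcard subsetIl -codegree2E nadj //= (mk _ _ uv euv).
    by rewrite -(deg u) leqnn.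
  by rewrite !inE euw.
by exists r, q; right.
Qed.

Lemma srg_nontrivial_mu_lt : ~ trivial_graph e -> (m < k)%N.
Proof.
have [sg _ deg adj nadj] := srg; rewrite ltnNge => ntriv; apply/negP => km.
apply/ntriv/srg_mu_trivial => u v uv euv; apply/eqP; rewrite eqn_leq km andbT.
by rewrite -(nadj u v) // codegree2E -(deg u) subset_leq_card ?subsetIl.
Qed.

Lemma srg_degree_le : (0 < n)%N -> (k <= n)%N.
Proof.
have [_ <- deg _ _] := srg => /card_gt0P[u _].
by rewrite -(deg u) max_card.
Qed.

(** * The adjacency matrix and its eigenvalues *)

Variable F : numFieldType.

Definition adjacency : 'M[F]_#|T| :=
  \matrix_(i, j) (e (enum_val i) (enum_val j))%:R.

Let J : 'M[F]_#|T| := const_mx 1.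

Lemma sum_enum_card (p : pred T) :
  \sum_(i < #|T|) (p (enum_val i))%:R = #|[set w | p w]|%:R :> F.
Proof.
rewrite -(big_enum_val (fun w => (p w)%:R)) /=.
rewrite -sum1dep_card natr_sum [RHS]big_mkcond.
by apply: eq_big => // w _; case: (p w).
Qed.

Lemma adjacency_mulJ : adjacency *m J = k%:R *: J.
Proof.
have [_ _ deg _ _] := srg; apply/matrixP => i j; rewrite !mxE mulr1.
under eq_bigr => h _ do rewrite !mxE mulr1.
by rewrite (sum_enum_card (e (enum_val i))) -(deg (enum_val i)).
Qed.

Lemma adjacency_Jmul : J *m adjacency = k%:R *: J.
Proof.
have [[esym _] _ _ _ _] := srg.
have adjT : adjacency^T = adjacency.
  by apply/matrixP => i j; rewrite !mxE esym.
have JT : J^T = J by apply/matrixP => i j; rewrite !mxE.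
by apply: trmx_inj; rewrite trmx_mul adjT JT adjacency_mulJ linearZ /= JT.
Qed.

Lemma JmulJ : J *m J = n%:R *: J.
Proof.
have [_ <- _ _ _] := srg; apply/matrixP => i j; rewrite !mxE.
under eq_bigr => h _ do rewrite !mxE mulr1.
by rewrite sumr_const card_ord mulr1.
Qed.

(** Entries of the square count common neighbours; on the diagonal this is the degree,
    [k = (k - m) + m]. *)
Lemma adjacency_sqr :
  adjacency *m adjacency =
  (k%:R - m%:R)%:M + (l%:R - m%:R) *: adjacency + m%:R *: J.
Proof.
have [[esym eirr] _ deg adj nadj] := srg; apply/matrixP => i j; rewrite !mxE.
set u := enum_val i; set v := enum_val j.
transitivity ((codegree e [set u; v])%:R : F).
  rewrite codegree2E; under eq_bigr => h _ do rewrite !mxE -natrM mulnb (esym _ v).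
  rewrite (sum_enum_card [pred w | e u w && e v w]); congr _%:R.
  by congr #|pred_of_set _|; apply/setP => w; rewrite !inE.
case: (eqVneq i j) => [ij|ij].
  rewrite /u /v -ij eirr codegree2E setIid mulr0n.
  by have := deg u; rewrite /degree /u => ->; rewrite mulr1n mulr0 mulr1 addr0 subrK.
have uv : u != v by rewrite (inj_eq enum_val_inj).
rewrite mulr0n add0r mulr1; case: (boolP (e u v)) => euv.
  by rewrite adj // mulr1 subrK.
by rewrite nadj // mulr0 add0r.
Qed.

(** Multiply [adjacency_sqr] by [J], on which [adjacency] acts as [k], and compare an entry. *)
Lemma srg_count : (0 < n)%N ->
  n%:R * m%:R = k%:R ^+ 2 - k%:R * (l%:R - m%:R) - (k%:R - m%:R) :> F.
Proof.
have [_ Tn _ _ _] := srg; rewrite -{1}Tn => T0; pose i := Ordinal T0.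
have : adjacency *m adjacency *m J = (k%:R ^+ 2) *: J.
  by rewrite -mulmxA adjacency_mulJ -scalemxAr adjacency_mulJ scalerA expr2.
rewrite adjacency_sqr !mulmxDl mul_scalar_mx -!scalemxAl adjacency_mulJ JmulJ.
move/matrixP/(_ i i); rewrite !mxE !mulr1 => <-; ring.
Qed.

(* [r] is the multiplicity of the eigenvalue [t] of the adjacency matrix. *)
Lemma srg_order_le_exp_mult (s t : F) : (0 < n)%N ->
  s + t = l%:R - m%:R -> s * t = m%:R - k%:R -> s != t -> s != 0 -> s != -1 ->
  exists2 r : nat,
    r%:R = (s - n%:R * s - k%:R) / (t - s) & (n <= 4 ^ r)%N.
Proof.
move=> n0 spt smt st s0 s1; have [[esym eirr] Tn _ _ _] := srg.
have nN0 : n%:R != 0 :> F by rewrite pnatr_eq0 -lt0n.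
have ts0 : t - s != 0 by rewrite subr_eq0 eq_sym.
(* This value makes [P] kill the all-ones vector, so that [P] projects onto the [t]-eigenvectors
   orthogonal to it. *)
pose c : F := (k%:R - s) / n%:R.
pose P := (t - s)^-1 *: (adjacency - s%:M - c *: J).
have PP : P *m P = P.
  rewrite /P -scalemxAl -scalemxAr; congr (_ *: _).
  apply: (scalerI ts0); rewrite scalerA divff // scale1r.
  rewrite !(mulmxBl, mulmxBr, mul_scalar_mx, mul_mx_scalar).
  rewrite -!scalemxAl -!scalemxAr !(adjacency_mulJ, adjacency_Jmul, JmulJ).
  rewrite adjacency_sqr -spt.
  (* [srg_count] factors as [n m = (k - s) (k - t)], which makes the coefficients of [J] agree. *)
  have mE : m%:R = c * (k%:R - t).
    rewrite /c; apply: (mulfI nN0); rewrite srg_count // -spt.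
    have -> : k%:R - m%:R = - (s * t) :> F by rewrite smt; ring.
    by field.
  have kE : k%:R - m%:R = - (s * t) by rewrite smt; ring.
  have nE : c * n%:R = k%:R - s by rewrite /c; field.
  rewrite kE mE; apply/matrixP => i j; rewrite !mxE.
  rewrite !mulr1 nE; move: (e _ _)%:R => a.
  by case: (i == j); rewrite ?mulr1n ?mulr0n; ring.
exists (\rank P).
  rewrite idempotent_rank_trace // /P mxtraceZ !raddfB /= mxtrace_scalar mxtraceZ.
  have -> : \tr adjacency = 0 by rewrite /mxtrace big1 // => i _; rewrite mxE eirr.
  have -> : \tr J = n%:R.
    rewrite /mxtrace (eq_bigr (fun=> 1)) => [|i _]; last by rewrite mxE.
    by rewrite sumr_const card_ord Tn.
  by rewrite Tn /c -mulr_natl sub0r; field; apply/andP.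
pose g (b : bool * bool) : F := (t - s)^-1 * (b.2%:R - s *+ b.1 - c).
pose col (i j : 'I_#|T|) := (i == j, e (enum_val i) (enum_val j)).
have cardC : #|{: bool * bool}| = 4%N by rewrite card_prod card_bool.
rewrite -[X in (X <= _)%N]Tn -cardC.
apply: (@row_count_le_exp_rank _ _ _ _ P g col).
  by move=> i j; rewrite /P !mxE mulr1.
(* If rows [i] and [j] agree, column [j] equates an off-diagonal 0 or 1 with the diagonal [- s],
   after the common scaling and shift. *)
move=> i j /rowP/(_ j); rewrite !mxE eqxx eirr !mulr1.
move/(mulfI (invr_neq0 ts0))/addIr; case: eqVneq => // ij.
rewrite mulr0n subr0 mulr1n sub0r; case: (e _ _) => /eqP.
  by rewrite -eqr_oppLR eq_sym (negPf s1).
by rewrite eq_sym oppr_eq0 (negPf s0).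
Qed.

End StronglyRegular.

Unset Implicit Arguments.

(** * Asymptotic estimates *)

Lemma srg_lambda_sub_mu_lt (R : realType) (delta : R) : 0 < delta ->
  exists n0 : nat,
    forall (T : finType) (e : rel T) (n k l m : nat),
      strongly_regular e n k l m -> ~ trivial_graph e -> (n0 <= n)%N ->
      `|l%:R - m%:R| < delta * n%:R.
Proof.
(* [N] exceeds every possible rank: the trace is at most [n (2 / delta + 1)] divided by
   [delta n]. *)
move=> delta0; pose N := Num.bound ((2 / delta + 1) / delta).
have N0 : 0 <= (2 / delta + 1) / delta.
  by rewrite divr_ge0 ?addr_ge0 ?divr_ge0 // ltW.
have Nbound : (2 / delta + 1) / delta < N%:R by have := archi_boundP N0.
exists (4 ^ N).+1 => T e n k l m srg ntriv lt_n.
rewrite ltNge; apply/negP => le_d.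
have n0 : (0 < n)%N by apply: leq_trans lt_n.
have nR : 0 < n%:R :> R by rewrite ltr0n.
have mk := srg_nontrivial_mu_lt srg ntriv.
have kn := srg_degree_le srg n0.
have mkR : m%:R < k%:R :> R by rewrite ltr_nat.
have knR : k%:R <= n%:R :> R by rewrite ler_nat.
have mR : 0 <= m%:R :> R by [].
pose d : R := l%:R - m%:R; rewrite -/d in le_d.
have D0 : 0 <= d ^+ 2 + 4 * (k%:R - m%:R) by have := sqr_ge0 d; lra.
pose D := Num.sqrt (d ^+ 2 + 4 * (k%:R - m%:R)).
have D2 : D ^+ 2 = d ^+ 2 + 4 * (k%:R - m%:R) by rewrite sqr_sqrtr.
have D_ge0 : 0 <= D by rewrite sqrtr_ge0.
have dD : `|d| <= D.
  by rewrite -ler_sqr ?nnegrE // real_normK ?num_real // D2; lra.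
have dn0 : 0 < delta * n%:R by apply: mulr_gt0.
(* [t] is a root of largest absolute value, [|t| = (|d| + D) / 2], where [D] is the square root of
   the discriminant. *)
have [t [spt smt [tD td]]] : exists t : R,
    [/\ (d - t) + t = d, (d - t) * t = m%:R - k%:R &
        `|t - (d - t)| = D /\ `|d| <= 2 * `|t|].
  case: (lerP 0 d) => d0.
    exists ((d + D) / 2); split; [by ring| |].
      transitivity ((d ^+ 2 - D ^+ 2) / 4); [by field | by rewrite D2; field].
    by rewrite !ger0_norm; lra.
  exists ((d - D) / 2); split; [by ring| |].
    transitivity ((d ^+ 2 - D ^+ 2) / 4); [by field | by rewrite D2; field].
  by rewrite !ler0_norm; lra.
move: (d - t) spt smt tD => s spt smt tD.
have D_gt0 : 0 < D by lra.
have ts0 : t - s != 0 by rewrite -normr_gt0 tD.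
have st : s != t by apply: contra_neq ts0 => ->; rewrite subrr.
have s0 : s != 0 by apply: contra_eq_neq smt => ->; rewrite mul0r; lra.
(* If [s = -1], the product of the roots gives [t = k - m], and their sum then gives [l + 1 = k]. *)
have s1 : s != -1.
  apply/eqP => sN1; apply: ntriv; apply: (srg_lambda_trivial srg).
  apply/eqP; rewrite -(eqr_nat R) -natr1; apply/eqP.
  by move: spt smt; rewrite sN1 /d; lra.
have [r rE n_le] := srg_order_le_exp_mult srg n0 spt smt st s0 s1.
(* Here [|s| |t| = k - m <= n], while [2 |t| >= |d| >= delta n]. *)
have s_le : `|s| <= 2 / delta.
  rewrite ler_pdivlMr //.
  have : `|s| * `|t| <= n%:R.
    by rewrite -normrM smt ler0_norm; lra.
  have : delta * n%:R * `|s| <= 2 * `|t| * `|s|.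
    by apply: ler_wpM2r => //; lra.
  have := normr_ge0 s; move: `|s| `|t| => a b a0 H1 H2.
  by rewrite -(ler_pM2r nR); lra.
have : r%:R < N%:R :> R.
  apply: le_lt_trans Nbound; rewrite -[r%:R]ger0_norm // rE normrM normfV tD.
  have num_le : `|s - n%:R * s - k%:R| <= n%:R * (2 / delta + 1).
    have n1 : 1 <= n%:R :> R by rewrite ler1n.
    have -> : s - n%:R * s - k%:R = - ((n%:R - 1) * s + k%:R) by ring.
    rewrite normrN; apply: le_trans (ler_normD _ _) _.
    rewrite normrM normr_nat [`|_ - 1|]ger0_norm; last by lra.
    rewrite mulrDr mulr1 lerD //; apply: ler_pM => //; lra.
  rewrite ler_pdivrMr //; apply: le_trans num_le _.
  have -> : n%:R * (2 / delta + 1) = (2 / delta + 1) / delta * (delta * n%:R).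
    by field; rewrite gt_eqF.
  by apply: ler_wpM2l => //; lra.
rewrite ltr_nat => rN; move: lt_n; rewrite ltnNge => /negP; apply.
by apply: leq_trans n_le _; rewrite leq_exp2l // ltnW.
Qed.

Theorem theorem1 (R : realType) (eps : R) (eps_gt0 : 0 < eps) :
  exists n0 : nat,
    forall (T : finType) (e : rel T) (n k lambda mu : nat),
      strongly_regular e n k lambda mu ->
      ~ trivial_graph e ->
      (n0 <= n)%N ->
      `|lambda%:R - k%:R ^+ 2 / n%:R| <= eps * n%:R /\
      `|mu%:R - k%:R ^+ 2 / n%:R| <= eps * n%:R.
Proof.
(* The errors will be at most [|d| + 1] for [m] and [2 |d| + 1] for [l]; the threshold puts both
   [|d|] and [1] below [eps n / 3]. *)
have eps3 : 0 < eps / 3 by lra.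
have [n1 n1P] := srg_lambda_sub_mu_lt R (eps / 3) eps3.
have eps30 : 0 <= 3 / eps by rewrite divr_ge0 // ltW.
exists (maxn n1 (Num.bound (3 / eps))).
move=> T e n k l m srg ntriv; rewrite geq_max => /andP[n1n n2n].
have := n1P T e n k l m srg ntriv n1n; set d := l%:R - m%:R => d_lt.
have nbig : 3 / eps < n%:R.
  by apply: lt_le_trans (archi_boundP eps30) _; rewrite ler_nat.
have nR : 0 < n%:R :> R by apply: le_lt_trans nbig.
have n0 : (0 < n)%N by rewrite -(ltr0n R).
have mkR : m%:R < k%:R :> R by rewrite ltr_nat (srg_nontrivial_mu_lt srg).
have knR : k%:R <= n%:R :> R by rewrite ler_nat (srg_degree_le srg).
have mR : 0 <= m%:R :> R by [].
have en : 3 < eps * n%:R by rewrite mulrC -ltr_pdivrMr.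
have cnt := srg_count srg R n0; rewrite -/d in cnt.
(* This is [srg_count] divided by [n]; the ratios [k / n] and [(k - m) / n] both lie between 0 and
   1. *)
have mE : m%:R - k%:R ^+ 2 / n%:R = - ((k%:R / n%:R) * d) - (k%:R - m%:R) / n%:R.
  apply: (mulfI (lt0r_neq0 nR)); rewrite mulrBr cnt.
  by field; rewrite lt0r_neq0.
have lE : l%:R - k%:R ^+ 2 / n%:R = d + (m%:R - k%:R ^+ 2 / n%:R) by rewrite /d; ring.
have m_le : `|m%:R - k%:R ^+ 2 / n%:R| <= `|d| + 1.
  rewrite mE; apply: le_trans (ler_normB _ _) _; rewrite normrN normrM.
  have kn1 : k%:R / n%:R <= 1 :> R by rewrite ler_pdivrMr // mul1r.
  have kn0 : 0 <= k%:R / n%:R :> R by rewrite divr_ge0.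
  have km0 : 0 <= (k%:R - m%:R) / n%:R :> R by rewrite divr_ge0 //; lra.
  rewrite [`|_ / _|]ger0_norm // [`|_ / _|]ger0_norm //; apply: lerD.
    by rewrite ler_piMl.
  by rewrite ler_pdivrMr // mul1r; lra.
split; last by lra.
by rewrite lE; apply: le_trans (ler_normD _ _) _; lra.
Qed.
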